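(* Let $X$ be a countably based topological space which admits a compatible bicomplete quasi-metric. Then a subset $Y\subseteq X$ (with the subspace topology) admits a compatible bicomplete quasi-metric if and only if $Y\in\mathbf{\Pi}^0_3(X)$.
   Context: A quasi-metric on a set $X$ is a function $d\colon X\times X\to[0,\infty)$ with $x=y$ iff $d(x,y)=d(y,x)=0$ and $d(x,z)\le d(x,y)+d(y,z)$; it induces the topology generated by $B_d(x,\varepsilon)=\{y\mid d(x,y)<\varepsilon\}$, and is compatible with a topology if it induces that topology. $(X,d)$ is bicomplete if the metric $\widehat d(x,y)=\max\{d(x,y),d(y,x)\}$ is complete. Borel hierarchy on a topological space $X$: $\mathbf{\Sigma}^0_1(X)$ = open sets; for $1<\alpha<\omega_1$, $\mathbf{\Sigma}^0_\alpha(X)$ consists of sets $\bigcup_{i\in\omega}(B_i\setminus B_i')$ with $B_i,B_i'\in\mathbf{\Sigma}^0_{\beta_i}(X)$, $\beta_i<\alpha$; $\mathbf{\Pi}^0_\alpha(X)$ = complements of $\mathbf{\Sigma}^0_\alpha(X)$ sets. *)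

(* Defs.v *)
From HB Require Import structures.
From mathcomp Require Import all_boot all_order all_algebra.
From mathcomp Require Import all_classical all_reals all_analysis.
From mathcomp Require Import Rstruct Rstruct_topology.
Set Implicit Arguments. Unset Strict Implicit. Unset Printing Implicit Defensive.
Import Order.TTheory GRing.Theory Num.Theory.
Local Open Scope classical_set_scope.
Local Open Scope ring_scope.

Notation Real := Rdefinitions.R.

Section QM.
Variable T : Type.

Definition quasi_metric (d : T -> T -> Real) : Prop :=
  (forall x y, 0 <= d x y) /\
  (forall x y, x = y <-> (d x y = 0 /\ d y x = 0)) /\
  (forall x y z, d x z <= d x y + d y z).

Definition qball (d : T -> T -> Real) (x : T) (e : Real) : set T :=
  [set y | d x y < e].

(* open sets of the topology generated by the balls B_d(x,e)
   (the balls form a base of this topology) *)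
Definition qm_open (d : T -> T -> Real) (U : set T) : Prop :=
  forall x, U x -> exists e : Real, 0 < e /\ qball d x e `<=` U.

Definition qm_compatible (O : set (set T)) (d : T -> T -> Real) : Prop :=
  forall U, O U <-> qm_open d U.

Definition sym_dist (d : T -> T -> Real) (x y : T) : Real :=
  Num.max (d x y) (d y x).

Definition bicomplete (d : T -> T -> Real) : Prop :=
  forall u : nat -> T,
    (forall e : Real, 0 < e -> exists N, forall m n, (N <= m)%N -> (N <= n)%N ->
        sym_dist d (u m) (u n) < e) ->
    exists x, forall e : Real, 0 < e -> exists N, forall n, (N <= n)%N ->
        sym_dist d (u n) x < e.

Definition admits_bicomplete_qm (O : set (set T)) : Prop :=
  exists d, quasi_metric d /\ qm_compatible O d /\ bicomplete d.

Definition countably_based (O : set (set T)) : Prop :=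
  exists B : nat -> set T, (forall n, O (B n)) /\
    forall U, O U -> forall x, U x -> exists n, B n x /\ B n `<=` U.

Inductive Sigma0 (O : set (set T)) : nat -> set T -> Prop :=
  | Sigma0_open A : O A -> Sigma0 O 1 A
  | Sigma0_union (n : nat) (b : nat -> nat) (B B' : nat -> set T) :
      (1 < n)%N -> (forall i, (1 <= b i < n)%N) ->
      (forall i, Sigma0 O (b i) (B i)) -> (forall i, Sigma0 O (b i) (B' i)) ->
      Sigma0 O n (\bigcup_i (B i `\` B' i)).

Definition Pi0 (O : set (set T)) (n : nat) (A : set T) : Prop :=
  Sigma0 O n (~` A).

End QM.

Definition subspace_open (X : topologicalType) (Y : set X) : set (set {x : X | Y x}) :=
  [set U | exists V : set X, open V /\ U = (@proj1_sig X Y) @^-1` V].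

(* Main.v *)
Require Import Defs.
From mathcomp Require Import all_boot all_order all_algebra.
From mathcomp Require Import all_classical all_reals all_analysis.
From mathcomp Require Import Rstruct Rstruct_topology lra.
Import Order.TTheory GRing.Theory Num.Theory.
Local Open Scope classical_set_scope.

(* If Y carries a compatible bicomplete quasi-metric d, cover Y for each n by
   countably many relatively locally closed sets of small symmetric diameter.
   The points of X lying in the X-closures of nested such pieces form a Pi^0_3
   set; such a point is the limit of a Cauchy sequence of Y, and countably many
   further conditions "open implies open" force it to have the same
   neighbourhoods as the limit in Y.

   Conversely, if Y is the intersection of sets S_n, each a countable union of
   differences U_nj \ V_nj of open sets, add to the quasi-metric of X two kinds
   of terms. The terms [wall] make all U_nj and V_nj clopen for the symmetrized
   metric without losing bicompleteness. The second kind, one for each n, is the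
   0/1 quasi-metric of a preorder: code x by its membership in (U_nj, V_nj) for
   j up to the first j with x in U_nj \ V_nj, and compare codes
   lexicographically. Moving to a nearby point can only increase the code, so
   the topology of Y is unchanged, and along a Cauchy sequence the code
   stabilizes, so that the limit stays in S_n. *)

Section BicompleteSubspaces.
Local Open Scope ring_scope.

(** * Radii, open balls and inner parts of open sets *)

Definition inv_succ (n : nat) : Rdefinitions.R := n.+1%:R^-1.

Lemma inv_succ_gt0 (n : nat) : 0 < inv_succ n.
Proof. by rewrite /inv_succ invr_gt0 ltr0n. Qed.

Lemma inv_succ_le (m n : nat) : (m <= n)%N -> inv_succ n <= inv_succ m.
Proof. by move=> mn; rewrite /inv_succ lef_pV2 ?posrE ?ltr0n// ler_nat. Qed.

Lemma inv_succ_lt (e : Rdefinitions.R) : 0 < e ->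
  exists N, forall n, (N <= n)%N -> inv_succ n < e.
Proof.
move=> /ltr_add_invr[N]; rewrite add0r => Ne; exists N => n Nn.
exact: le_lt_trans (inv_succ_le _ _ Nn) Ne.
Qed.

Lemma qm_refl {T : Type} {d : T -> T -> Rdefinitions.R} (hd : quasi_metric d)
  (x : T) : d x x = 0.
Proof. by have [_ [/(_ x x)[/(_ erefl)[]]]] := hd. Qed.

Lemma sym_dist_lt {T : Type} (d : T -> T -> Rdefinitions.R) (x y : T)
  (e : Rdefinitions.R) : sym_dist d x y < e <-> d x y < e /\ d y x < e.
Proof. by rewrite /sym_dist gt_max; split => [/andP|[-> ->]]. Qed.

Lemma qm_open_qball {T : Type} {d : T -> T -> Rdefinitions.R}
  (hd : quasi_metric d) (x : T) (e : Rdefinitions.R) : qm_open d (qball d x e).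
Proof.
move=> y /= dxy; have [_ [_ tri]] := hd.
exists (e - d x y); split; first by rewrite subr_gt0.
by move=> z /=; rewrite /qball /=; move: (tri x y z); lra.
Qed.

(** The strict inequality [e < e'] leaves the slack that makes this set open; with balls of radius
    exactly [e], openness can fail. *)
Definition qm_inner {T : Type} (d : T -> T -> Rdefinitions.R) (U : set T)
  (e : Rdefinitions.R) : set T :=
  [set x | exists e', e < e' /\ qball d x e' `<=` U].

Lemma qm_inner_open {T : Type} {d : T -> T -> Rdefinitions.R}
  (hd : quasi_metric d) (U : set T) (e : Rdefinitions.R) :
  qm_open d (qm_inner d U e).
Proof.
have [_ [_ tri]] := hd.
move=> x [e' [ee' xU]]; exists ((e' - e) / 2); split; first lra.
move=> y; rewrite /qball /= => xy; exists ((e + e') / 2); split; first lra.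
by move=> z; rewrite /qball /= => yz; apply: xU; rewrite /qball /=;
  move: (tri x y z); lra.
Qed.

Lemma qm_inner_sub {T : Type} {d : T -> T -> Rdefinitions.R} {U : set T}
  {e : Rdefinitions.R} {x y : T} : qm_inner d U e x -> d x y < e -> U y.
Proof.
by move=> [e' [ee' xU]] xy; apply: xU; rewrite /qball /=; exact: lt_trans ee'.
Qed.

Lemma bigcup_qm_inner {T : Type} {d : T -> T -> Rdefinitions.R}
  (hd : quasi_metric d) (U : set T) : qm_open d U ->
  U = \bigcup_m qm_inner d U (inv_succ m).
Proof.
move=> oU; apply/seteqP; split => [x Ux|x [m _ hx]].
  have [e [e0 xU]] := oU x Ux.
  have [N /(_ N (leqnn N)) Ne] := inv_succ_lt _ e0.
  by exists N => //; exists e.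
by apply: (qm_inner_sub hx); rewrite qm_refl// inv_succ_gt0.
Qed.

(** * Low Borel levels through countable unions of differences of open sets *)

Definition union_of_differences {X : topologicalType} (S : set X) : Prop :=
  exists U V : nat -> set X, (forall i, open (U i)) /\ (forall i, open (V i)) /\
    S = \bigcup_i (U i `\` V i).

Lemma Sigma0_1 {X : topologicalType} {A : set X} : Sigma0 (@open X) 1 A -> open A.
Proof. by move=> h; inversion h. Qed.

(** Levels 1 and 2 are treated together, since the pieces of a level 3 set may have either level. *)
Lemma Sigma0_union_of_differences {X : topologicalType} (n : nat) (A : set X) :
  (n < 3)%N -> Sigma0 (@open X) n A -> union_of_differences A.
Proof.
move=> n3 h; case: h n3 => [B oB _|{}n b B B' n1 hb hB hB' n3].
  exists (fun=> B), (fun=> set0); split=> //; split; first by move=> _; exact: open0.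
  by rewrite setD0 bigcup_const.
have b1 i : b i = 1%N.
  have /andP[b_gt0 bn] := hb i; apply/eqP.
  by rewrite eqn_leq b_gt0 andbT -ltnS (leq_trans bn).
exists B, B'; split; first by move=> i; have := hB i; rewrite b1 => /Sigma0_1.
by split=> // i; have := hB' i; rewrite b1 => /Sigma0_1.
Qed.

Lemma union_of_differences_Sigma0 {X : topologicalType} (A : set X) :
  union_of_differences A -> Sigma0 (@open X) 2 A.
Proof.
move=> [U [V [oU [oV ->]]]].
by apply: (@Sigma0_union _ _ 2 (fun=> 1%N)) => // i; exact: Sigma0_open.
Qed.

Lemma union_of_differences_open {X : topologicalType} (A : set X) :
  open A -> union_of_differences A.
Proof. by move=> oA; apply: (@Sigma0_union_of_differences _ 1) => //; exact: Sigma0_open. Qed.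

Lemma union_of_differences_bigcup {X : topologicalType} (I : countType)
  (A : I -> set X) : (forall i, union_of_differences (A i)) ->
  union_of_differences (\bigcup_i A i).
Proof.
move=> /choice[U /choice[V hA]].
(* Numbers that code no pair contribute an empty difference. *)
pose F (W : I -> nat -> set X) n :=
  if unpickle n is Some (i, j) then W i j else set0.
have oF W : (forall i j, open (W i j)) -> forall n, open (F W n).
  by move=> oW n; rewrite /F; case: unpickle => [[i j]//|]; exact: open0.
exists (F U), (F V); split; first by apply: oF => i; exact: (hA i).1.
split; first by apply: oF => i; exact: (hA i).2.1.
apply/seteqP; split => [x [i _]|x [n _]].
  rewrite (hA i).2.2 => -[j _ hx]; exists (pickle (i, j)) => //.
  by rewrite /F pickleK.
rewrite /F; case: unpickle => [[i j] hx|[]//].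
by exists i => //; rewrite (hA i).2.2; exists j.
Qed.

Lemma Sigma0_3_bigcup {X : topologicalType} (I : countType)
  (P Q : I -> set X) : (forall i, union_of_differences (P i)) ->
  (forall i, union_of_differences (Q i)) ->
  Sigma0 (@open X) 3 (\bigcup_i (P i `\` Q i)).
Proof.
move=> hP hQ; pose F (W : I -> set X) n :=
  if unpickle n is Some i then W i else set0.
have hF W : (forall i, union_of_differences (W i)) ->
    forall n, Sigma0 (@open X) 2 (F W n).
  move=> hW n; apply: union_of_differences_Sigma0; rewrite /F.
  by case: unpickle => // ; exact: union_of_differences_open open0.
have -> : \bigcup_i (P i `\` Q i) = \bigcup_n (F P n `\` F Q n).
  apply/seteqP; split => [x [i _ hx]|x [n _]].
    by exists (pickle i) => //; rewrite /F pickleK.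
  by rewrite /F; case: unpickle => [i hx|[]//]; exists i.
by apply: (@Sigma0_union _ _ 3 (fun=> 2%N)) => // n; exact: hF.
Qed.

(** Once each [B i] is written as the union over [j] of [U i j] minus [V i j], De Morgan turns [Y]
    into an intersection over pairs [(i, j)] of three-term unions: the complement of [U i j], then
    [V i j], then [B' i]. *)
Lemma Pi0_3_bigcap {X : topologicalType} (Y : set X) : Pi0 (@open X) 3 Y ->
  exists S : nat -> set X, (forall n, union_of_differences (S n)) /\
    Y = \bigcap_n S n.
Proof.
rewrite /Pi0; move m3 : 3%N => m; move YE : (~` Y) => C h.
case: h m3 YE => [//|{}m b B B' _ hb hB hB' m3 YE]; rewrite -m3 in hb.
have /choice[U /choice[V hUV]] i : union_of_differences (B i).
  by apply: Sigma0_union_of_differences (hB i); have /andP[] := hb i.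
have hB2 i : union_of_differences (B' i).
  by apply: Sigma0_union_of_differences (hB' i); have /andP[] := hb i.
pose S n := if unpickle n is Some (i, j) then ~` U i j `|` V i j `|` B' i else setT.
exists S; split=> [n|].
  rewrite /S; case: unpickle => [[i j]|]; last first.
    exact: union_of_differences_open openT.
  pose A (k : 'I_3) := if k == 0%N :> nat then ~` U i j else
    if k == 1%N :> nat then V i j else B' i.
  have -> : ~` U i j `|` V i j `|` B' i = \bigcup_k A k.
    apply/seteqP; split => [x [[|]|]|x [[[|[|[|//]]] k3] _]]; rewrite /A /=.
    - by exists (inord 0) => //; rewrite inordK.
    - by exists (inord 1) => //; rewrite inordK.
    - by exists (inord 2) => //; rewrite inordK.
    - by left; left.
    - by left; right.
    - by right.
  apply: union_of_differences_bigcup => k; rewrite /A.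
  case: ifP => _; first last.
    case: ifP => _; last exact: hB2.
    by apply: union_of_differences_open; exact: (hUV i).2.1.
  exists (fun=> setT), (fun=> U i j); split; first by move=> _; exact: openT.
  split; first by move=> _; exact: (hUV i).1.
  by rewrite setTD bigcup_const.
rewrite -[Y]setCK YE; apply/seteqP; split=> [x hx n _|x hx [i _ []]].
  rewrite /S; case: unpickle => [[i j]|//].
  apply: contrapT => hn; apply: hx; exists i => //; split.
    rewrite (hUV i).2.2; exists j => //; split; apply: contrapT => h'; apply: hn.
      by left; left.
    by left; right; exact: contrapT.
  by move=> h'; apply: hn; right.
rewrite (hUV i).2.2 => -[j _ [Uj Vj]] B'x.
by have := hx (pickle (i, j)) I; rewrite /S pickleK => -[[]|].
Qed.

(** * Separation by open sets, and cells in the ambient space *)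

Lemma qm_T0 {X : topologicalType} {d : X -> X -> Rdefinitions.R} (x y : X) :
  quasi_metric d -> qm_compatible (@open X) d ->
  (forall U, open U -> U x <-> U y) -> x = y.
Proof.
move=> hd cd h; have [d0 [sep _]] := hd.
(* When [d u v] is positive, the ball of that radius around [u] is open and misses [v]. *)
have far u v : (forall U : set X, open U -> U u -> U v) -> d u v = 0.
  move=> uv; apply/eqP; rewrite eq_le d0 andbT leNgt; apply/negP => duv.
  have /uv : open (qball d u (d u v)) by apply/cd; exact: qm_open_qball.
  by rewrite /qball /= qm_refl// ltxx => /(_ duv).
by apply/sep; split; apply: far => U oU Ux; apply/(h U oU).
Qed.

Section Trace.
Context {X : topologicalType} {T : Type}.
Variables (p : T -> X) (d : T -> T -> Rdefinitions.R) (B : nat -> set X).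

(* Any two points of [uniform_nbhd n k] are [inv_succ n]-close in both directions. *)
Definition uniform_nbhd (n k : nat) : set T :=
  [set t | B k (p t) /\ forall w, B k (p w) -> d t w < inv_succ n].

(** The latest index is at the head, and the length of the tail sets the precision. The closure,
    taken in [X], admits points outside the range of [p]; meeting it with [B k] keeps those points
    inside the basic set being refined. *)
Fixpoint cell (s : seq nat) : set X :=
  if s is k :: s' then
    closure (p @` (uniform_nbhd (size s') k `&` p @^-1` cell s')) `&` B k `&` cell s'
  else setT.

(** A canonical open set of [X] representing [U]: its preimage is [U] itself as soon as [U] is the
    preimage of some open set. *)
Definition max_trace (U : set T) : set X :=
  \bigcup_(V in [set V | open V /\ p @^-1` V `<=` U]) V.

End Trace.

Lemma open_max_trace {X : topologicalType} {T : Type} (p : T -> X) (U : set T) :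
  open (max_trace p U).
Proof. by apply: bigcup_open => V []. Qed.

Lemma max_trace_sub {X : topologicalType} {T : Type} {p : T -> X} {U : set T} (t : T) :
  max_trace p U (p t) -> U t.
Proof. by move=> [V [_ VU] /VU]. Qed.

(** A new index meets the open part with [B k] and adds the complement of the closure to the removed
    part, so one difference always suffices. *)
Lemma cell_difference {X : topologicalType} {T : Type} (p : T -> X)
  (d : T -> T -> Rdefinitions.R) {B : nat -> set X} (s : seq nat) :
  (forall k, open (B k)) ->
  exists U V, open U /\ open V /\ cell p d B s = U `\` V.
Proof.
move=> oB; elim: s => [|k s [U [V [oU [oV /= ->]]]]] /=.
  by exists setT, set0; rewrite setD0; split; [exact: openT|split; [exact: open0|]].
set C := closure _; exists (B k `&` U), (V `|` ~` C); split; first exact: openI.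
split; first by apply: openU => //; apply: closed_openC; exact: closed_closure.
by rewrite !setDE setCU setCK; apply/seteqP; split=> x; rewrite /=; tauto.
Qed.

Lemma union_of_differences_cell {X : topologicalType} {T : Type} (p : T -> X)
  (d : T -> T -> Rdefinitions.R) {B : nat -> set X} (s : seq nat) :
  (forall k, open (B k)) -> union_of_differences (cell p d B s).
Proof.
move=> /(@cell_difference _ _ p d _ s)[U [V [oU [oV ->]]]].
by exists (fun=> U), (fun=> V); split=> //; split=> //; rewrite bigcup_const.
Qed.

(** * Branches of cells, and necessity of the Borel condition *)

Section Range.
Context {X : topologicalType} {T : Type}.
Variables (p : T -> X) (d : T -> T -> Rdefinitions.R) (B : nat -> set X).
Hypothesis oB : forall k, open (B k).
Hypothesis baseB : forall U, open U -> forall x, U x -> exists k, B k x /\ B k `<=` U.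
Hypothesis hd : quasi_metric d.
Hypothesis cd : qm_compatible [set U | exists V, open V /\ U = p @^-1` V] d.

Lemma qball_trace (t : T) (e : Rdefinitions.R) : 0 < e ->
  exists V, open V /\ V (p t) /\ forall w, V (p w) -> d t w < e.
Proof.
move=> e0; have /cd[V [oV VE]] := qm_open_qball hd t e.
have VP w : V (p w) = (d t w < e) by rewrite -[LHS]/((p @^-1` V) w) -VE.
by exists V; split=> //; split=> [|w]; rewrite VP ?qm_refl.
Qed.

Lemma uniform_nbhd_cover (n : nat) (t : T) : exists k, uniform_nbhd p d B n k t.
Proof.
have [V [oV [Vt hV]]] := qball_trace t _ (inv_succ_gt0 n).
have [k [Bk kV]] := baseB V oV _ Vt; exists k; split=> [|w wk]; first exact: Bk.
exact: (hV _ (kV _ wk)).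
Qed.

Lemma max_traceE (U : set T) (t : T) : qm_open d U -> U t -> max_trace p U (p t).
Proof. by move=> /cd[V [oV ->]] Vt; exists V => //; split. Qed.

Lemma cell_cover (s : seq nat) (t : T) : cell p d B s (p t) ->
  exists k, cell p d B (k :: s) (p t).
Proof.
move=> st; have [k tk] := uniform_nbhd_cover (size s) t; exists k => /=.
split=> //; split; last exact: tk.1.
by apply: subset_closure; exists t.
Qed.

Section Branch.
Variables (x : X) (k : nat -> nat) (s : nat -> seq nat).
Hypothesis sS : forall n, s n.+1 = k n :: s n.
Hypothesis size_s : forall n, size (s n) = n.
Hypothesis sx : forall n, cell p d B (s n) x.

Definition branch_nbhd (n : nat) : set T :=
  uniform_nbhd p d B n (k n) `&` p @^-1` cell p d B (s n).

Lemma branch_closure (n : nat) (z : X) : cell p d B (s n.+1) z ->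
  closure (p @` branch_nbhd n) z /\ B (k n) z.
Proof. by rewrite sS /= size_s => -[[]]. Qed.

Lemma cell_decr (m n : nat) : (n <= m)%N -> cell p d B (s m) `<=` cell p d B (s n).
Proof.
elim: m => [|m IH]; first by rewrite leqn0 => /eqP ->.
rewrite leq_eqVlt => /orP[/eqP -> //|]; rewrite ltnS => /IH nm z.
by rewrite sS /= => -[_ /nm].
Qed.

(** For [n < m] the point [p z] lies in [B (k n)], which bounds [d z' z]. It also lies in the
    closure of the image of [branch_nbhd n], so some [w] there has [d z w] small, and [w] is
    uniformly close to [z']; hence the factor 2. *)
Lemma branch_close (m n : nat) (z z' : T) : (n <= m)%N ->
  branch_nbhd m z -> branch_nbhd n z' -> sym_dist d z z' < 2 * inv_succ n.
Proof.
move=> nm hz hz'; have r0 := inv_succ_gt0 n; have [_ [_ tri]] := hd.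
apply/sym_dist_lt; move: nm; rewrite leq_eqVlt => /orP[/eqP nm|nm].
  subst m; have h1 := hz.1.2 _ hz'.1.1; have h2 := hz'.1.2 _ hz.1.1; lra.
have [clz Bz] := branch_closure n _ (cell_decr _ _ nm _ hz.2).
have h2 := hz'.1.2 _ Bz; split; last lra.
have [V [oV [Vz hV]]] := qball_trace z _ r0.
have [_ [[w hw <-] /hV h1]] := clz V (open_nbhs_nbhs (conj oV Vz)).
have h3 := hw.1.2 _ hz'.1.1.
by move: (tri z w z'); lra.
Qed.

(** Points picked from the successive neighbourhoods form a Cauchy sequence, and its limit attracts
    the whole of each late neighbourhood because all points of one neighbourhood are mutually
    close. *)
Lemma branch_limit : bicomplete d -> exists y, forall e, 0 < e ->
  exists n, inv_succ n < e /\ forall z, branch_nbhd n z -> sym_dist d z y < e.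
Proof.
move=> bd; have [_ [_ tri]] := hd.
have ex n : exists z, branch_nbhd n z.
  have [h _] := branch_closure n x (sx n.+1).
  by have [_ [[z hz _] _]] := h setT filterT; exists z.
have [z hz] := choice ex.
have [|y hy] := bd z.
  move=> e e0; have [|N hN] := inv_succ_lt (e / 2); first lra.
  exists N => m n Nm Nn; wlog nm : m n Nm Nn / (n <= m)%N.
    move=> h; have [/h|/ltnW/h] := leqP n m; first exact.
    by move=> h'; apply/sym_dist_lt/and_comm/sym_dist_lt; exact: h'.
  apply: lt_trans (branch_close _ _ _ _ nm (hz m) (hz n)) _.
  by have := hN n Nn; lra.
(* A point of [branch_nbhd n] is within [e / 2] of [z n], by the factor 2 in [branch_close], and
   [z n] is within [e / 4] of [y]. *)
exists y => e e0; have [|N hN] := inv_succ_lt (e / 4); first lra.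
have [|M hM] := hy (e / 4); first lra.
pose n := maxn N M; exists n; have rn := hN n (leq_maxl _ _).
split=> [|w hw]; first lra.
have /sym_dist_lt[h1 h2] := hM n (leq_maxr _ _).
have /sym_dist_lt[h3 h4] := branch_close _ _ _ _ (leqnn n) hw (hz n).
apply/sym_dist_lt; move: (tri w (z n) y) (tri y (z n) w); lra.
Qed.

End Branch.

(** Dependent choice: [f] is total on sequences, with an arbitrary value where the cell does not
    contain [x]. *)
Lemma cell_branch (x : X) :
  (forall s, cell p d B s x -> exists k, cell p d B (k :: s) x) ->
  exists k s, (forall n, s n.+1 = k n :: s n) /\ (forall n, size (s n) = n) /\
    forall n, cell p d B (s n) x.
Proof.
move=> h.
have /choice[f hf] s : exists k, cell p d B s x -> cell p d B (k :: s) x.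
  by have [/h[k sk]|ns] := pselect (cell p d B s x); [exists k|exists 0%N].
pose s := fix s n := if n is n'.+1 then f (s n') :: s n' else [::].
exists (fun n => f (s n)), s; split=> //; split; first by elim=> //= n ->.
by elim=> // n IH; exact: hf.
Qed.

Lemma Pi0_3_range : bicomplete d ->
  (forall x y : X, (forall U, open U -> U x <-> U y) -> x = y) ->
  Pi0 (@open X) 3 (range p).
Proof.
move=> bd T0; have [_ [_ tri]] := hd.
(* The families of [P `\` Q] excluded from the range: branches of cells must
   not stop, and open sets implying one another on the range must do so in [X]. *)
have oI l : qm_open d (p @^-1` B l) by apply/cd; exists (B l).
pose inner l m := max_trace p (qm_inner d (p @^-1` B l) (inv_succ m)).
pose P (i : seq nat + (nat + nat)) := match i with
  | inl s => cell p d B s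
  | inr (inl l) => max_trace p (p @^-1` B l)
  | inr (inr l) => B l end.
pose Q (i : seq nat + (nat + nat)) := match i with
  | inl s => \bigcup_k cell p d B (k :: s)
  | inr (inl l) => B l
  | inr (inr l) => \bigcup_m inner l m end.
suff YE : ~` range p = \bigcup_i (P i `\` Q i).
  rewrite /Pi0 YE; apply: Sigma0_3_bigcup => -[s|[l|l]] /=.
  - exact: union_of_differences_cell.
  - by apply: union_of_differences_open; exact: open_max_trace.
  - exact: union_of_differences_open.
  - by apply: union_of_differences_bigcup => k;
      exact: (union_of_differences_cell p d (k :: s)).
  - exact: union_of_differences_open.
  - apply: union_of_differences_open; apply: bigcup_open => m _.
    exact: open_max_trace.
apply/seteqP; split; last first.
  move=> x [[s|[l|l]] _ [/= hP hQ]] [t _ tx]; subst; apply: hQ.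
  - by have [k hk] := cell_cover _ _ hP; exists k.
  - exact: max_trace_sub hP.
  - move: (hP); rewrite -[B l (p t)]/((p @^-1` B l) t) (bigcup_qm_inner hd _ (oI l)).
    by move=> [m _ hm]; exists m => //; apply: max_traceE => //; exact: qm_inner_open.
move=> x nx; apply: contrapT => hx; apply: nx.
have PQ i : P i x -> Q i x by move=> Pi; apply: contrapT => nQ; apply: hx; exists i.
have [|k [s [sS [size_s sx]]]] := cell_branch x.
  by move=> s /(PQ (inl s))[k _ hk]; exists k.
have [y hy] := branch_limit x k s sS size_s sx bd.
have clx n := branch_closure k s sS size_s n x (sx n.+1).
exists y => //; apply/esym/T0.
have Bxy l : B l x <-> B l (p y).
  (* The open set [inner l m] contains [x], hence meets the image of every [branch_nbhd n]. A common
     point is near [y] for suitable [n], and its margin [inv_succ m] puts [y] in the trace of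
     [B l]. *)
  split=> [/(PQ (inr (inr l)))[m _ xm]|yl].
    have [n [_ hn]] := hy _ (inv_succ_gt0 m).
    have [] := (clx n).1 _ (open_nbhs_nbhs (conj (open_max_trace p _) xm)).
    move=> w [[z hz <-{w}] zm].
    by have /sym_dist_lt[zy _] := hn z hz; exact: qm_inner_sub (max_trace_sub _ zm) zy.
  (* For suitable [n] the trace of all of [B (k n)] lies in a small ball around [y], hence in the
     trace of [B l]. So [B (k n)], which contains [x], is one of the open sets joined in
     [max_trace]. *)
  apply: (PQ (inr (inl l))); have [e [e0 ye]] := oI l y yl.
  have [|n [rn hn]] := hy (e / 2); first lra.
  have [] := (clx n).1 setT filterT => _ [[z hz _] _].
  exists (B (k n)); last exact: (clx n).2.
  split=> // w kw; apply: ye; rewrite /qball /=.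
  have /sym_dist_lt[_ yz] := hn z hz; have zw := hz.1.2 w kw.
  by move: (tri y z w); lra.
move=> U oU; split=> [Ux|Uy].
  by have [l [xl lU]] := baseB U oU _ Ux; apply/lU/Bxy.
by have [l [yl lU]] := baseB U oU _ Uy; apply/lU/Bxy.
Qed.

End Range.

(** * Countable suprema of pseudo-quasi-metrics, and refinement of a bicomplete quasi-metric *)

Lemma filter_forall_leq {T : Type} {F : set_system T} {FF : Filter F}
  (A : nat -> set T) (N : nat) : (forall i, F (A i)) ->
  F [set x | forall i, (i <= N)%N -> A i x].
Proof.
move=> hA; elim: N => [|N IH].
  by apply: filterS (hA 0%N) => x Ax i; rewrite leqn0 => /eqP ->.
apply: filterS (filterI IH (hA N.+1)) => x [h1 h2] i.
by rewrite leq_eqVlt ltnS => /orP[/eqP ->|/h1].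
Qed.

Definition pseudo_qm {T : Type} (f : T -> T -> Rdefinitions.R) : Prop :=
  (forall x y, 0 <= f x y) /\ (forall x, f x x = 0) /\
  (forall x y z, f x z <= f x y + f y z).

(** Truncating [f n] at [inv_succ n] keeps the supremum finite and lets only finitely many [f n]
    matter at a given scale. *)
Definition sup_qm {T : Type} (f : nat -> T -> T -> Rdefinitions.R) (x y : T) :
  Rdefinitions.R := sup (range (fun n => Num.min (inv_succ n) (f n x y))).

Section SupQM.
Context {T : Type} (f : nat -> T -> T -> Rdefinitions.R).
Hypothesis hf : forall n, pseudo_qm (f n).

Lemma le_sup_qm (n : nat) (x y : T) : Num.min (inv_succ n) (f n x y) <= sup_qm f x y.
Proof.
apply: ub_le_sup; last by exists n.
exists 1 => _ [m _ <-]; apply: le_trans (_ : inv_succ m <= 1).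
  by rewrite ge_min lexx.
by apply: le_trans (inv_succ_le 0 m _) _ => //; rewrite /inv_succ invr1.
Qed.

Lemma sup_qm_le (x y : T) (c : Rdefinitions.R) :
  (forall n, Num.min (inv_succ n) (f n x y) <= c) -> sup_qm f x y <= c.
Proof.
move=> h; apply: ge_sup; first by exists (Num.min (inv_succ 0) (f 0%N x y)), 0%N.
by move=> _ [n _ <-].
Qed.

Lemma pseudo_qm_sup : pseudo_qm (sup_qm f).
Proof.
have pos x y : 0 <= sup_qm f x y.
  apply: le_trans (le_sup_qm 0 x y).
  by rewrite le_min (hf 0%N).1 ltW// inv_succ_gt0.
split=> //; split=> [x|x y z].
  apply/eqP; rewrite eq_le pos andbT; apply: sup_qm_le => n.
  by rewrite (hf n).2.1 ge_min lexx orbT.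
apply: sup_qm_le => n; have r0 := inv_succ_gt0 n.
have [f0 [_ /(_ x y z) tri]] := hf n.
apply: le_trans (lerD (le_sup_qm n x y) (le_sup_qm n y z)).
move: (f0 x y) (f0 y z).
by case: (leP (inv_succ n) (f n x y)); case: (leP (inv_succ n) (f n y z));
  case: (leP (inv_succ n) (f n x z)); lra.
Qed.

Lemma lt_sup_qm (n : nat) (x y : T) (e : Rdefinitions.R) :
  sup_qm f x y < Num.min (inv_succ n) e -> f n x y < e.
Proof.
move=> h; have := le_lt_trans (le_sup_qm n x y) h.
by rewrite lt_min !gt_min ltxx /= => /andP[fr /orP[|//]]; exact: lt_trans.
Qed.

Lemma sup_qm_le_initial (N : nat) (x y : T) (e : Rdefinitions.R) :
  inv_succ N <= e -> (forall n, (n <= N)%N -> f n x y < e) -> sup_qm f x y <= e.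
Proof.
move=> Ne h; apply: sup_qm_le => n; rewrite ge_min; have [/h/ltW -> |/ltnW Nn] := leqP n N.
  by rewrite orbT.
by rewrite (le_trans (inv_succ_le _ _ Nn) Ne).
Qed.

End SupQM.

(** The quasi-metric is [d] plus the supremum of the [f i]. Separation comes from [d] and
    injectivity of [p]; the topology does not grow because balls of each [f i] are traces of
    neighbourhoods; the last hypothesis brings limits found in [X] back to [T]. *)
Lemma bicomplete_qm_refine {X : topologicalType} {T : Type} (p : T -> X)
  (d : X -> X -> Rdefinitions.R) (I : countType) (f : I -> T -> T -> Rdefinitions.R) :
  quasi_metric d -> qm_compatible (@open X) d -> bicomplete d -> injective p ->
  (forall i, pseudo_qm (f i)) ->
  (forall i t e, 0 < e -> nbhs (p t) [set z | forall t', p t' = z -> f i t t' < e]) ->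
  (forall (u : nat -> T) (x : X),
     (forall e, 0 < e -> \forall n \near \oo, sym_dist d (p (u n)) x < e) ->
     (forall i e, 0 < e -> exists N, forall m n, (N <= m)%N -> (N <= n)%N ->
        f i (u m) (u n) < e) ->
     exists y, p y = x /\
       forall i e, 0 < e -> \forall n \near \oo, sym_dist (f i) (u n) y < e) ->
  admits_bicomplete_qm [set U | exists V, open V /\ U = p @^-1` V].
Proof.
move=> hd cd bd pinj hf nf lf; have [d0 [sep tri]] := hd.
pose F n := if unpickle n is Some i then f i else fun _ _ => 0.
have FE i : F (pickle i) = f i by rewrite /F pickleK.
have hF n : pseudo_qm (F n).
  rewrite /F; case: unpickle => [i|]; first exact: hf.
  by split=> //; split=> // *; rewrite addr0.
have [s0 [ss stri]] := pseudo_qm_sup F hF.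
pose D s t := d (p s) (p t) + sup_qm F s t.
have dD s t : d (p s) (p t) <= D s t by rewrite lerDl.
have sD s t : sup_qm F s t <= D s t by rewrite lerDr.
have ballD t e : 0 < e -> exists V, open V /\ V (p t) /\ p @^-1` V `<=` qball D t e.
  move=> e0; have [|N /(_ N (leqnn N)) hN] := inv_succ_lt (e / 2); first lra.
  (* Only indices up to [N] need a condition; truncation keeps the later ones below [e / 2]. *)
  pose W := [set z | forall n, (n <= N)%N -> forall t', p t' = z -> F n t t' < e / 2].
  have nW : nbhs (p t) W.
    apply: filter_forall_leq => n; rewrite /F; case: unpickle => [i|].
      by apply: nf; lra.
    by apply: filterS filterT => z _ t' _; lra.
  have oB : open (qball d (p t) (e / 2)) by apply/cd; exact: qm_open_qball.
  exists (qball d (p t) (e / 2) `&` W^°); split; first exact: openI (open_interior _).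
  split.
    split; last exact: nW.
    by rewrite /qball /= qm_refl//; lra.
  move=> t' [h1 /interior_subset h2]; rewrite /qball /= /D.
  have : sup_qm F t t' <= e / 2.
    by apply: (sup_qm_le_initial F N); [exact: ltW|move=> n /h2; exact].
  by move: h1; rewrite /qball /=; lra.
exists D; split; [|split].
- split=> [s t|]; first by rewrite addr_ge0.
  split=> [s t|s t w]; last by rewrite /D; move: (tri (p s) (p t) (p w)) (stri s t w); lra.
  split=> [->|[st ts]]; first by rewrite /D ss addr0 qm_refl.
  apply/pinj/sep; move: (dD s t) (dD t s) (d0 (p s) (p t)) (d0 (p t) (p s)); lra.
- move=> U; split=> [[V [/cd oV ->]] t /oV[e [e0 tV]]|oU].
    exists e; split=> // t' tt'; apply: tV.
    exact: le_lt_trans (dD t t') tt'.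
  exists (max_trace p U); split; first exact: open_max_trace.
  apply/seteqP; split=> t; last exact: max_trace_sub.
  move=> /oU[e [/(ballD t)[V [oV [Vt hV]]] eU]].
  by exists V => //; split=> //; exact: subset_trans hV eU.
move=> u cu.
have [|x hx] := bd (p \o u).
  move=> e /cu[N hN]; exists N => m n Nm Nn; have /sym_dist_lt[h1 h2] := hN m n Nm Nn.
  by apply/sym_dist_lt; split; exact: le_lt_trans (dD _ _) _.
have nx e : 0 < e -> \forall n \near \oo, sym_dist d (p (u n)) x < e.
  by move=> /hx[N hN]; exists N.
have [|y [yx hy]] := lf u x nx.
  move=> i e e0.
  have [|N hN] := cu (Num.min (inv_succ (pickle i)) e).
    by rewrite lt_min e0 inv_succ_gt0.
  exists N => m n Nm Nn; rewrite -FE; apply: (lt_sup_qm F).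
  have /sym_dist_lt[h _] := hN m n Nm Nn.
  exact: le_lt_trans (sD _ _) h.
exists y => e e0; have [|N /(_ N (leqnn N)) hN] := inv_succ_lt (e / 2); first lra.
have hF' : \forall k \near \oo, forall n, (n <= N)%N -> sym_dist (F n) (u k) y < e / 2.
  apply: (filter_forall_leq (fun n => [set k | sym_dist (F n) (u k) y < e / 2])) => n.
  rewrite /F; case: unpickle => [i|]; first by apply: hy; lra.
  by apply: filterS filterT => k _; apply/sym_dist_lt; split; lra.
have [|M _ hM] := filterI (nx (e / 2) _) hF'; first lra.
exists M => n /hM[]; rewrite -yx => /sym_dist_lt[h1 h2] h3.
have h4 : sup_qm F (u n) y <= e / 2.
  by apply: (sup_qm_le_initial F N); [exact: ltW|move=> k /h3/sym_dist_lt[]].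
have h5 : sup_qm F y (u n) <= e / 2.
  by apply: (sup_qm_le_initial F N); [exact: ltW|move=> k /h3/sym_dist_lt[]].
by apply/sym_dist_lt; rewrite /D; lra.
Qed.

(** * Walls: making an open set clopen for the symmetrized metric *)

Definition depth {X : Type} (d : X -> X -> Rdefinitions.R) (U : set X) (x : X) :
  Rdefinitions.R := sup [set e | 0 <= e <= 1 /\ qball d x e `<=` U].

(** Here [depth] is the distance to the complement of [U], capped at 1. With its inverse read as
    infinite outside [U], the wall is the positive part of the increment of that inverse, truncated
    at 1: a one-sided form of the classical remetrization of an open subset. *)
Definition wall {X : Type} (d : X -> X -> Rdefinitions.R) (U : set X) (x y : X) :
  Rdefinitions.R :=
  if `[< U x >] then
    if `[< U y >] then Num.min 1 (Num.max 0 ((depth d U y)^-1 - (depth d U x)^-1)) else 1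
  else 0.

(** One-sided continuity of the inverse, in the form that the one-sided bound [depth_tri] can
    feed. *)
Lemma inv_lt_add (a e : Rdefinitions.R) : 0 < a -> 0 < e ->
  exists eta, 0 < eta /\ forall b, a - eta < b -> 0 < b /\ b^-1 < a^-1 + e.
Proof.
move=> a0 e0; have ia : 0 < a^-1 by rewrite invr_gt0.
have c0 : 0 < (a^-1 + e)^-1 by rewrite invr_gt0; lra.
(* Chosen so that [a - eta] is exactly the inverse of [a^-1 + e]. *)
exists (a - (a^-1 + e)^-1); split.
  by rewrite subr_gt0 invf_plt ?posrE//; lra.
move=> b; rewrite opprB addrC subrK => cb; have b0 : 0 < b by exact: lt_trans cb.
by split=> //; rewrite invf_plt ?posrE//; lra.
Qed.

Lemma inv_gt_sub (a e : Rdefinitions.R) : 0 < a -> 0 < e ->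
  exists eta, 0 < eta /\ forall b, 0 < b -> b < a + eta -> a^-1 - e < b^-1.
Proof.
(* If [a^-1 <= e], positivity of [b^-1] is enough; otherwise [a^-1 - e] has a positive inverse,
   which serves as the bound on [b]. *)
move=> a0 e0; have [ae|ea] := leP a^-1 e.
  by exists 1; split=> // b b0 _; apply: le_lt_trans (_ : 0 < b^-1);
    [lra|rewrite invr_gt0].
have c0 : 0 < (a^-1 - e)^-1 by rewrite invr_gt0; lra.
exists ((a^-1 - e)^-1 - a); split.
  by rewrite subr_gt0 invf_pgt ?posrE//; lra.
move=> b b0; rewrite addrC subrK => bc.
by rewrite invf_pgt ?posrE//; lra.
Qed.

Section Wall.
Context {X : Type} (d : X -> X -> Rdefinitions.R) (U : set X).
Hypothesis hd : quasi_metric d.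
Hypothesis oU : qm_open d U.

Lemma depth_has_sup (x : X) : has_sup [set e | 0 <= e <= 1 /\ qball d x e `<=` U].
Proof.
split; last by exists 1 => e [/andP[]].
exists 0; split; first by rewrite lexx ler01.
by move=> y; rewrite /qball /= ltNge hd.1.
Qed.

Lemma depth_ub (x : X) (e : Rdefinitions.R) : 0 <= e <= 1 -> qball d x e `<=` U ->
  e <= depth d U x.
Proof. by move=> h1 h2; apply: ub_le_sup; [exact: (depth_has_sup x).2|split]. Qed.

Lemma depth_le (x : X) (c : Rdefinitions.R) :
  (forall e, 0 <= e <= 1 -> qball d x e `<=` U -> e <= c) -> depth d U x <= c.
Proof.
by move=> h; apply: ge_sup; [exact: (depth_has_sup x).1|move=> e [h1 h2]; exact: h].
Qed.

Lemma depth_ge0 (x : X) : 0 <= depth d U x.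
Proof.
apply: depth_ub; first by rewrite lexx ler01.
by move=> y; rewrite /qball /= ltNge hd.1.
Qed.

Lemma depth_gt0 (x : X) : U x -> 0 < depth d U x.
Proof.
move=> /oU[e [e0 xU]]; apply: lt_le_trans (_ : Num.min 1 e <= _).
  by rewrite lt_min ltr01.
apply: depth_ub; first by rewrite ge_min lexx le_min ler01 ltW.
by move=> y; rewrite /qball /= lt_min => /andP[_]; exact: xU.
Qed.

Lemma depth_out (x : X) : ~ U x -> depth d U x = 0.
Proof.
move=> nU; apply/eqP; rewrite eq_le depth_ge0 andbT; apply: depth_le => e _ xU.
rewrite leNgt; apply/negP => e0; apply: nU; apply: xU.
by rewrite /qball /= qm_refl.
Qed.

(** The ball of radius [e] around [x] contains the ball of radius [e - d x y] around [y]. *)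
Lemma depth_tri (x y : X) : depth d U x <= d x y + depth d U y.
Proof.
have [d0 [_ tri]] := hd; apply: depth_le => e /andP[e0 e1] xU.
have [exy|yxe] := leP e (d x y); first by move: (depth_ge0 y); lra.
rewrite -lerBlDl; apply: depth_ub; first by move: (d0 x y); lra.
by move=> z; rewrite /qball /= => yz; apply: xU; rewrite /qball /=;
  move: (tri x y z); lra.
Qed.

Lemma wall_in (x y : X) : U x -> U y ->
  wall d U x y = Num.min 1 (Num.max 0 ((depth d U y)^-1 - (depth d U x)^-1)).
Proof. by rewrite /wall => /asboolT -> /asboolT ->. Qed.

Lemma wall_exit (x y : X) : U x -> ~ U y -> wall d U x y = 1.
Proof. by rewrite /wall => /asboolT -> /asboolF ->. Qed.

Lemma wall_out (x y : X) : ~ U x -> wall d U x y = 0.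
Proof. by rewrite /wall => /asboolF ->. Qed.

Lemma pseudo_qm_wall : pseudo_qm (wall d U).
Proof.
have pos x y : 0 <= wall d U x y.
  rewrite /wall; case: ifP => // _; case: ifP => // _.
  by rewrite le_min ler01 le_max lexx.
split=> //; split=> [x|x y z].
  have [Ux|nU] := pselect (U x); last exact: wall_out.
  by rewrite wall_in// subrr maxxx; apply/min_idPr; exact: ler01.
have le1 s t : wall d U s t <= 1.
  rewrite /wall; case: ifP => // _; case: ifP => // _.
  by rewrite ge_min lexx.
have [Ux|nx] := pselect (U x); last by rewrite wall_out// addr_ge0.
have [Uy|ny] := pselect (U y); last first.
  by rewrite [wall d U x y]wall_exit//; move: (le1 x z) (pos y z); lra.
have [Uz|nz] := pselect (U z); last first.
  by rewrite [wall d U y z]wall_exit//; move: (le1 x z) (pos x y); lra.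
rewrite !wall_in//.
move: (depth d U z)^-1 (depth d U y)^-1 (depth d U x)^-1 => a b c.
have : Num.max 0 (a - c) <= Num.max 0 (b - c) + Num.max 0 (a - b).
  by case: (leP 0 (a - c)); case: (leP 0 (b - c)); case: (leP 0 (a - b)); lra.
have : 0 <= Num.max 0 (b - c) by rewrite le_max lexx.
have : 0 <= Num.max 0 (a - b) by rewrite le_max lexx.
move: (Num.max 0 (a - c)) (Num.max 0 (b - c)) (Num.max 0 (a - b)) => A B C.
by case: (leP 1 A); case: (leP 1 B); case: (leP 1 C); lra.
Qed.

Lemma wall_lt1 (x y : X) : sym_dist (wall d U) x y < 1 -> U x <-> U y.
Proof.
move=> /sym_dist_lt[h1 h2]; split=> [Ux|Uy]; apply: contrapT => n.
  by move: h1; rewrite wall_exit// ltxx.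
by move: h2; rewrite wall_exit// ltxx.
Qed.

(** By [depth_tri], a short move from [x] can lower the depth only slightly, so it neither leaves
    [U] nor raises the inverse much. This keeps the topology unchanged when walls are added. *)
Lemma wall_forward (x : X) (e : Rdefinitions.R) : 0 < e ->
  exists eta, 0 < eta /\ forall y, d x y < eta -> wall d U x y < e.
Proof.
move=> e0; have [Ux|nU] := pselect (U x); last first.
  by exists 1; split=> // y _; rewrite wall_out.
have [eta [eta0 h]] := inv_lt_add _ _ (depth_gt0 _ Ux) e0.
exists eta; split=> // y xy.
have [|y0 hy] := h (depth d U y); first by move: (depth_tri x y); lra.
have Uy : U y by apply: contrapT => /depth_out y0'; move: y0; rewrite y0' ltxx.
by rewrite wall_in// gt_min gt_max e0 /=; apply/orP; right; lra.
Qed.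

(** The triangle bound now runs the other way: the depth at [y] exceeds that at [x] by at most
    [d y x], so its inverse cannot be much smaller. *)
Lemma wall_backward (x : X) (e : Rdefinitions.R) : U x -> 0 < e ->
  exists eta, 0 < eta /\ forall y, U y -> d y x < eta -> wall d U y x < e.
Proof.
move=> Ux e0; have [eta [eta0 h]] := inv_gt_sub _ _ (depth_gt0 _ Ux) e0.
exists eta; split=> // y Uy yx.
have hy := h _ (depth_gt0 _ Uy); rewrite wall_in// gt_min gt_max e0 /=.
apply/orP; right; have := hy _; move: (depth_tri y x) => ?.
by move=> /(_ ltac:(lra)); lra.
Qed.

(* A sequence cannot leave [U] in the limit, since [1 / depth] would be unbounded along it. *)
Lemma wall_limit (v : nat -> X) (x : X) :
  (forall e, 0 < e -> \forall n \near \oo, sym_dist d (v n) x < e) ->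
  (forall e, 0 < e -> exists N, forall m n, (N <= m)%N -> (N <= n)%N ->
     wall d U (v m) (v n) < e) ->
  forall e, 0 < e -> \forall n \near \oo, sym_dist (wall d U) (v n) x < e.
Proof.
move=> vx cv e e0; have [eta [eta0 hf]] := wall_forward x _ e0.
suff : \forall n \near \oo, wall d U (v n) x < e.
  move=> h; apply: filterS2 h (vx _ eta0) => n h1 /sym_dist_lt[_ h2].
  by apply/sym_dist_lt; split=> //; exact: hf.
have [Ux|nx] := pselect (U x).
  have [eta' [eta'0 hb]] := wall_backward x _ Ux e0.
  have [eps [eps0 xU]] := oU x Ux.
  apply: filterS2 (vx _ eta'0) (vx _ eps0) => n /sym_dist_lt[h1 _] /sym_dist_lt[_ h2].
  exact: hb (xU _ h2) h1.
have [N hN] := cv 1 ltr01; exists N => // n /= Nn.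
rewrite wall_out// => Un.
(* A depth below [c] at [v m] would make the inverse depth grow by more than 1 from [v n], against
   the Cauchy bound 1 on the wall. *)
pose c := ((depth d U (v n))^-1 + 1)^-1.
have i0 : 0 < (depth d U (v n))^-1 by rewrite invr_gt0 depth_gt0.
have c0 : 0 < c by rewrite invr_gt0; lra.
have [M _ hM] := vx _ c0; pose m := maxn N M.
have /sym_dist_lt[mx _] := hM m (leq_maxr _ _).
have nm := hN n m Nn (leq_maxl _ _).
have Um : U (v m) by apply: contrapT => nU; move: nm; rewrite wall_exit// ltxx.
move: nm; rewrite wall_in// gt_min ltxx gt_max ltr01 /= => hm.
have := depth_tri (v m) x; rewrite (depth_out _ nx) addr0 => mx'.
have mc : depth d U (v m) < c by exact: le_lt_trans mx.
have : c^-1 < (depth d U (v m))^-1 by rewrite ltf_pV2 ?posrE// depth_gt0.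
by rewrite /c invrK; lra.
Qed.

End Wall.

(* The lexicographic preorder on sequences truncated just after their first [1]. *)
Definition prefix_le (a b : nat -> nat) : Prop :=
  forall j, (forall i, (i < j)%N -> a i = b i /\ a i <> 1%N) -> (a j <= b j)%N.

(** Where [a] and [c] agree before any 1, [b] is squeezed between them, so it agrees too and the two
    comparisons at [j] can be chained. *)
Lemma prefix_le_trans (a b c : nat -> nat) :
  prefix_le a b -> prefix_le b c -> prefix_le a c.
Proof.
move=> ab bc j hac.
have hab : forall i, (i < j)%N -> a i = b i.
  elim/ltn_ind => i IH ij; apply/eqP; rewrite eqn_leq.
  have hai i' : (i' < i)%N -> a i' = b i' /\ a i' <> 1%N.
    by move=> ii'; have i'j := ltn_trans ii' ij; split;
      [exact: IH|exact: (hac _ i'j).2].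
  rewrite ab//= (hac i ij).1; apply: bc => i' ii'.
  by have [<- ?] := hai _ ii'; rewrite -(hac _ (ltn_trans ii' ij)).1.
apply: leq_trans (ab j _) (bc j _) => i ij; first by split; [exact: hab|exact: (hac i ij).2].
by rewrite -hab//; exact: hac.
Qed.

(** Nothing after a 1 of [a] is ever compared. *)
Lemma prefix_le_agree (a b : nat -> nat) (j : nat) : a j = 1%N ->
  (forall i, (i <= j)%N -> a i = b i) -> prefix_le a b.
Proof.
move=> aj ab k hk; have [/ab -> //|/hk[_]] := leqP k j.
by rewrite aj.
Qed.

Lemma prefix_le_antisym (a b : nat -> nat) (j : nat) :
  (forall i, (i < j)%N -> a i <> 1%N) -> prefix_le a b -> prefix_le b a ->
  forall i, (i <= j)%N -> a i = b i.
Proof.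
move=> aj ab ba; elim/ltn_ind => i IH ij; apply/eqP; rewrite eqn_leq.
rewrite ab ?ba// => k ki; have kj := leq_trans ki ij.
  by rewrite -(IH k ki (ltnW kj)); split=> //; exact: aj.
by split; [exact: IH (ltnW kj)|exact: aj].
Qed.

(** * Codes of points relative to a sequence of pairs of open sets *)

Section Code.
Context {X : Type} (U V : nat -> set X).

(** The value is 0 outside [U j], 1 on [U j] minus [V j], and 2 on the intersection. This order
    makes each entry lower semicontinuous when [U j] and [V j] are open. *)
Definition code (x : X) (j : nat) : nat := `[< U j x >] + `[< U j x /\ V j x >].

Lemma code_eq1 (x : X) (j : nat) : code x j = 1%N <-> (U j `\` V j) x.
Proof.
rewrite /code; case: asboolP => [Ux|nU]; case: asboolP => [[? Vx]|nV].
- by split=> [|[]].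
- by split=> // _; split=> // Vx; apply: nV.
- by [].
- by split=> [|[]].
Qed.

Lemma code_leq (x y : X) (j : nat) : (U j x -> U j y) -> (V j x -> V j y) ->
  (code x j <= code y j)%N.
Proof.
rewrite /code => hU hV; apply: leq_add.
  by case: asboolP => // /hU/asboolT ->.
by case: asboolP => // -[/hU Uy /hV Vy]; rewrite asboolT.
Qed.

Lemma code_eq (x y : X) (j : nat) : (U j x <-> U j y) -> (V j x <-> V j y) ->
  code x j = code y j.
Proof. by move=> [? ?] [? ?]; apply/eqP; rewrite eqn_leq !code_leq. Qed.

End Code.

(** Only entries up to a position with value 1 are compared, so finitely many open conditions
    suffice. *)
Lemma nbhs_prefix_le_code {X : topologicalType} (U V : nat -> set X) (x : X) :
  (forall j, open (U j)) -> (forall j, open (V j)) ->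
  (exists j, (U j `\` V j) x) ->
  nbhs x [set y | prefix_le (code U V x) (code U V y)].
Proof.
move=> oU oV [j /code_eq1 xj].
have near_imp (W : set X) : open W -> nbhs x [set y | W x -> W y].
  move=> oW; have [Wx|nW] := pselect (W x); last by apply: filterS filterT => y _ /nW.
  by apply: filterS (open_nbhs_nbhs (conj oW Wx)) => y Wy _.
apply: filterS (filter_forall_leq (fun i => [set y | (code U V x i <= code U V y i)%N]) j _).
  move=> y h k hk; have [/h //|/hk[_]] := leqP k j.
  by rewrite xj.
move=> i; apply: filterS2 (near_imp _ (oU i)) (near_imp _ (oV i)) => y.
exact: code_leq.
Qed.

(** * Zero-one quasi-metrics of preorders, and sufficiency of the Borel condition *)

Definition preorder_qm {T : Type} (le : T -> T -> Prop) (x y : T) : Rdefinitions.R :=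
  if `[< le x y >] then 0 else 1.

Lemma preorder_qm_lt1 {T : Type} (le : T -> T -> Prop) (x y : T) :
  preorder_qm le x y < 1 <-> le x y.
Proof.
by rewrite /preorder_qm; case: asboolP => h; split=> //; rewrite ?ltr01 ?ltxx.
Qed.

Lemma preorder_qmE {T : Type} (le : T -> T -> Prop) (x y : T) :
  le x y -> preorder_qm le x y = 0.
Proof. by rewrite /preorder_qm => /asboolT ->. Qed.

Lemma pseudo_qm_preorder {T : Type} (le : T -> T -> Prop) :
  (forall x, le x x) -> (forall x y z, le x y -> le y z -> le x z) ->
  pseudo_qm (preorder_qm le).
Proof.
move=> refl trans; have pos x y : 0 <= preorder_qm le x y.
  by rewrite /preorder_qm; case: ifP.
split=> //; split=> [x|x y z]; first exact: preorder_qmE.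
have [xy|nxy] := pselect (le x y); last first.
  rewrite {2}/preorder_qm asboolF//; apply: le_trans (_ : 1 <= _).
    by rewrite /preorder_qm; case: ifP.
  by rewrite lerDl.
have [yz|nyz] := pselect (le y z); last first.
  rewrite {3}/preorder_qm asboolF//; apply: le_trans (_ : 1 <= _).
    by rewrite /preorder_qm; case: ifP.
  by rewrite lerDr.
by rewrite (preorder_qmE _ _ _ (trans _ _ _ xy yz)) addr_ge0.
Qed.

Lemma bicomplete_qm_bigcap {X : topologicalType} {T : Type} (p : T -> X)
  (d : X -> X -> Rdefinitions.R) (S : nat -> set X) :
  quasi_metric d -> qm_compatible (@open X) d -> bicomplete d -> injective p ->
  (forall n, union_of_differences (S n)) -> range p = \bigcap_n S n ->
  admits_bicomplete_qm [set U | exists V, open V /\ U = p @^-1` V].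
Proof.
move=> hd cd bd pinj /choice[U /choice[V hUV]] pS.
have oU n j : open (U n j) by exact: (hUV n).1.
have oV n j : open (V n j) by exact: (hUV n).2.1.
have SE n : S n = \bigcup_j (U n j `\` V n j) by exact: (hUV n).2.2.
have Sp n t : exists j, (U n j `\` V n j) (p t).
  have : (\bigcap_n S n) (p t) by rewrite -pS; exists t.
  by move=> /(_ n I); rewrite SE => -[j _ h]; exists j.
pose c n t := code (U n) (V n) (p t).
pose le n s t := prefix_le (c n s) (c n t).
pose G (b : bool) n j := if b then U n j else V n j.
have oG b n j : open (G b n j) by case: b; [exact: oU|exact: oV].
pose f (i : nat + bool * (nat * nat)) (s t : T) := match i with
  | inl n => preorder_qm (le n) s t
  | inr (b, (n, j)) => wall d (G b n j) (p s) (p t) end.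
apply: (@bicomplete_qm_refine _ _ p d _ f) => //.
- move=> [n|[b [n j]]] /=.
    apply: pseudo_qm_preorder => [t|r s t]; last exact: prefix_le_trans.
    by have [j /code_eq1 tj] := Sp n t; exact: prefix_le_agree tj _.
  have [w0 [w1 w2]] := pseudo_qm_wall d (G b n j).
  by split=> [s t|]; [exact: w0|split=> [t|r s t]; [exact: w1|exact: w2]].
- move=> [n|[b [n j]]] t e e0 /=.
    apply: filterS (nbhs_prefix_le_code _ _ _ (oU n) (oV n) (Sp n t)).
    by move=> z h t' tz; rewrite preorder_qmE// /le /c tz.
  have [eta [eta0 h]] := wall_forward d (G b n j) hd (proj1 (cd _) (oG b n j)) (p t) e e0.
  have oB : open (qball d (p t) eta) by apply/cd; exact: qm_open_qball.
  have tB : qball d (p t) eta (p t) by rewrite /qball /= qm_refl.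
  by apply: filterS (open_nbhs_nbhs (conj oB tB)) => z hz t' tz; rewrite tz; exact: h.
move=> u x ux cu.
have lw b n j e (e0 : 0 < e) :
    \forall k \near \oo, sym_dist (wall d (G b n j)) (p (u k)) x < e.
  apply: (wall_limit d (G b n j) hd (proj1 (cd _) (oG b n j)) (p \o u)) => // e' e'0.
  exact: (cu (inr (b, (n, j)))).
(* Within distance 1 no wall is crossed, so membership of [p (u k)] in each [U n j] and [V n j]
   eventually agrees with that of [x]. *)
have lG b n j : \forall k \near \oo, G b n j (p (u k)) <-> G b n j x.
  by apply: filterS (lw b n j 1 ltr01) => k; exact: wall_lt1.
have lc n : exists j, (U n j `\` V n j) x /\
    \forall k \near \oo, c n (u k) j = 1%N /\
      forall i, (i <= j)%N -> c n (u k) i = code (U n) (V n) x i.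
  (* A zero-one distance below 1 is a comparison, so from [N] on all codes compare both ways. They
     therefore coincide up to the first 1 of the code of [u N], at position [j]. *)
  have [N hN] := cu (inl n) 1 ltr01.
  have ex : exists j, c n (u N) j == 1%N.
    by have [j /code_eq1 hj] := Sp n (u N); exists j; apply/eqP.
  have [j /eqP jN jmin] := ex_minnP ex.
  have nj i : (i < j)%N -> c n (u N) i <> 1%N.
    by move=> ij /eqP/jmin; rewrite leqNgt ij.
  have lk : \forall k \near \oo, forall i, (i <= j)%N -> c n (u N) i = c n (u k) i.
    exists N => // k /= Nk; apply: prefix_le_antisym => //; apply/preorder_qm_lt1.
      exact: hN.
    exact: hN.
  have lx : \forall k \near \oo, forall i, (i <= j)%N ->
      c n (u k) i = code (U n) (V n) x i.
    apply: (filter_forall_leq (fun i => [set k | c n (u k) i = code (U n) (V n) x i])) => i.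
    by apply: filterS2 (lG true n i) (lG false n i) => k; exact: code_eq.
  (* The code of [x] inherits the 1 at [j], which places [x] in [S n]. *)
  exists j; split.
    apply/code_eq1; have [k _ hk] := filterI lk lx.
    by have [h1 h2] := hk k (leqnn k); rewrite -h2// -h1.
  apply: filterS2 lk lx => k h1 h2; split=> //.
  by rewrite -h1.
have : range p x.
  by rewrite pS => n _; have [j [hj _]] := lc n; rewrite SE; exists j.
move=> [y _ yx]; exists y; split=> // -[n|[b [n j]]] e e0 /=; last first.
  by move: (lw b n j e e0); rewrite -yx.
have [j [_ hj]] := lc n; apply: filterS hj => k [kj hk].
have yj i : (i <= j)%N -> c n (u k) i = c n y i by rewrite /c yx; exact: hk.
apply/sym_dist_lt; split; rewrite /f preorder_qmE//.
  exact: prefix_le_agree kj yj.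
by apply: (@prefix_le_agree _ _ j) => [|i ij]; rewrite -yj.
Qed.

End BicompleteSubspaces.

Theorem theorem32 (X : topologicalType) :
  countably_based (@open X) ->
  admits_bicomplete_qm (@open X) ->
  forall Y : set X,
    admits_bicomplete_qm (@subspace_open X Y) <-> Pi0 (@open X) 3 Y.
Proof.
move=> [B [oB baseB]] [d [hd [cd bd]]] Y.
pose p := @proj1_sig X Y.
have pY : range p = Y.
  by apply/seteqP; split=> [_ [[x Yx] _ <-] //|x Yx]; exists (exist Y x Yx).
split=> [[e [he [ce be]]]|/Pi0_3_bigcap[S [hS YS]]].
  rewrite -pY; apply: (Pi0_3_range p e B) => //.
  by move=> x y; exact: qm_T0 hd cd.
apply: (bicomplete_qm_bigcap p d S) => //; last by rewrite pY.
by move=> [x Yx] [y Yy] /= xy; subst y; congr exist; exact: Prop_irrelevance.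
Qed.
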